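(* Let $N$ be a Lagrangian submanifold of the symplectic vector space $(V^{2n},\omega)$, let $\gamma$ be a closed curve in $N$, and let $G:\gamma\to L(V)$, $G(x)=T_xN$, be the Gaussian map. Let $p:U(n)\to U(n)/O(n)=L(V)$ be the natural projection. If there is a continuous map $\widetilde{G}:\gamma\to U(n)$ with $p\circ\widetilde{G}=G$, then the Maslov index $$\ell(\gamma)=\int_\gamma(\det{}^2\circ G)^*\,\frac{dz}{2\pi i z}$$ is an even number.
   Context: $(V^{2n},\omega)$ is a real symplectic vector space of dimension $2n$, and $L(V)$ is its Lagrange Grassmannian, the space of all Lagrangian $n$-planes, i.e. $n$-planes on which $\omega$ vanishes. Fixing a Lagrangian plane $X\in L(V)$ (and a compatible Hermitian structure, so that the unitary group $U(n)$ acts on $V$ and acts transitively on $L(V)$ with stabilizer of $X$ equal to the canonically embedded $O(n)\subset U(n)$), one identifies $L(V)=U(n)/O(n)$. The map $\det^2:U(n)/O(n)\to S^1=\{z\in\mathbb{C}:|z|=1\}$ is induced by $U\mapsto(\det U)^2$, and $\frac{dz}{2\pi i z}$ is regarded as a 1-form on $S^1$. A submanifold $N\subset V^{2n}$ is Lagrangian if at each $x\in N$ the tangent plane $T_xN$ is a maximal isotropic plane for $\omega$; $T_xN$ is regarded as an element of $L(V)$ via the canonical identification $T_xV=V$. *)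

(* Defs.v *)
From HB Require Import structures.
From mathcomp Require Import all_boot all_order all_algebra complex.
From mathcomp Require Import all_classical all_reals all_analysis.

Set Implicit Arguments.
Unset Strict Implicit.
Unset Printing Implicit Defensive.

Import Order.TTheory GRing.Theory Num.Theory numFieldNormedType.Exports.

Local Open Scope classical_set_scope.
Local Open Scope ring_scope.
Local Open Scope complex_scope.

(* Finite-dimensional normed spaces.  All norms on such a space are
   equivalent, so the norm only serves to carry the canonical topology and
   differential calculus of the underlying vector space. *)
#[short(type="normedVectType")]
HB.structure Definition NormedVector (R : numFieldType) :=
  {V of NormedModule R V & Vector R V}.

HB.instance Definition _ (R : realType) (m n : nat) :=
  NormedModule.on 'M[R]_(m.+1, n.+1).

Section Smoothness.
Context {R : realType}.

(* Meant for an open set A and a finite-dimensional domain: there, continuity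
   of x |-> 'D_v f x for each fixed v is continuity of the differential. *)
Fixpoint Ck_on {V W : normedModType R} (k : nat) (A : set V) (f : V -> W)
    {struct k} : Prop :=
  if k is k'.+1 then
    (forall x, A x -> differentiable f x) /\
    (forall v : V, Ck_on k' A (fun x => 'D_v f x))
  else forall x, A x -> {for x, continuous f}.

Definition smooth_on {V W : normedModType R} (A : set V) (f : V -> W) : Prop :=
  forall k, Ck_on k A f.

Definition diffeomorphism {V W : normedModType R} (A : set V) (B : set W)
    (f : V -> W) (g : W -> V) : Prop :=
  [/\ smooth_on A f, smooth_on B g,
      forall x, A x -> B (f x) /\ g (f x) = x
    & forall y, B y -> A (g y) /\ f (g y) = y].

(* A closed curve on [0, 1], continuous and piecewise C^1; C^1 on a closed
   subinterval means being the restriction of a C^1 map on the line. *)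
Definition piecewise_C1_closed_curve {V : normedModType R} (c : R -> V) : Prop :=
  c 0 = c 1 /\
  exists (m : nat) (s : nat -> R),
    [/\ s 0%N = 0, s m = 1 &
        forall i, (i < m)%N -> s i < s i.+1 /\
          exists2 g : R -> V, Ck_on 1 [set: R] g &
            {in `[s i, s i.+1], c =1 g}].

End Smoothness.

Section Submanifold.
Context {R : realType} {V : normedVectType R}.
Implicit Types (N : set V) (x : V).

Definition submanifold (d : nat) N : Prop :=
  forall x, N x ->
  exists (A B : set V) (f g : V -> V) (E : {vspace V}),
    [/\ open A /\ A x, open B, diffeomorphism A B f g, \dim E = d
      & forall y, A y -> (N y <-> f y \in E)].

Definition velocities N x : set V :=
  [set v | exists (I : set R) (c : R -> V),
    [/\ open I /\ I 0, smooth_on I c, forall t, I t -> N (c t),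
        c 0 = x & derive1 c 0 = v]].

(* The set of velocities is a subspace when N is a submanifold; 0 is only a
   default value. *)
Definition tangent_plane N x : {vspace V} :=
  xget 0%VS [set T : {vspace V} | [set v | v \in T] = velocities N x].

End Submanifold.

Section Symplectic.
Context {R : realType} {V : normedVectType R}.
Variable omega : {skew_symmetric V}.
Implicit Types L T : {vspace V}.

Definition isotropic T : Prop :=
  forall u v, u \in T -> v \in T -> omega u v = 0.

Definition maximal_isotropic T : Prop :=
  isotropic T /\ forall T', isotropic T' -> (T <= T')%VS -> T' = T.

Definition lagrangian_plane (n : nat) L : Prop := \dim L = n /\ isotropic L.

Definition lagrangian_submanifold (N : set V) : Prop :=
  (exists d, submanifold d N) /\
  forall x, N x -> maximal_isotropic (tangent_plane N x).

Definition compatible_complex_structure (J : 'End(V)) : Prop :=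
  [/\ forall v, J (J v) = - v,
      forall u v, omega (J u) (J v) = omega u v
    & forall v, v != 0 -> 0 < omega v (J v)].

(* V is a complex vector space through J, with the Hermitian product
   h(u, v) = omega(u, J v) - i omega(u, v), complex linear in u. *)
Definition cscale (J : 'End(V)) (z : R[i]) (v : V) : V :=
  complex.Re z *: v + complex.Im z *: J v.

Definition herm (J : 'End(V)) (u v : V) : R[i] :=
  (omega u (J v)) +i* (- omega u v).

Definition orthonormal_basis (J : 'End(V)) (n : nat) L (e : n.-tuple V) : Prop :=
  basis_of L e /\
  forall i j : 'I_n, herm J (tnth e i) (tnth e j) = (i == j)%:R.

(* The action on V of a complex matrix, in the Hermitian basis e. *)
Definition unitary_act (J : 'End(V)) (n : nat) (e : n.-tuple V) (U : 'M[R[i]]_n)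
    (v : V) : V :=
  \sum_(k < n) cscale J
    ((U *m \col_(l < n) herm J v (tnth e l)) k 0) (tnth e k).

(* The projection U(n) -> U(n)/O(n) = L(V), U |-> U(X). *)
Definition lagr_proj (J : 'End(V)) (n : nat) (X : {vspace V}) (e : n.-tuple V)
    (U : 'M[R[i]]_n) : {vspace V} :=
  (linfun (unitary_act J e U) @: X)%VS.

(* det^2 is independent of the unitary matrix chosen over L; off L(V) its
   value is irrelevant. *)
Definition det2 (J : 'End(V)) (n : nat) (X : {vspace V}) (e : n.-tuple V)
    L : R[i] :=
  (\det (xget 1%:M [set U : 'M[R[i]]_n | U \is unitarymx /\ lagr_proj J X e U = L]))
    ^+ 2.

End Symplectic.

Section LineIntegral.
Context {R : realType}.

Definition cderive (z : R -> R[i]) (t : R) : R[i] :=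
  derive1 (fun s => complex.Re (z s)) t +i* derive1 (fun s => complex.Im (z s)) t.

Definition cintegral (a b : R) (f : R -> R[i]) : R[i] :=
  (\int[lebesgue_measure]_(t in `[a, b]) complex.Re (f t))
  +i* (\int[lebesgue_measure]_(t in `[a, b]) complex.Im (f t)).

(* The integral over [0, 1] of the pull-back by z of dz / (2 pi i z). *)
Definition winding_integral (z : R -> R[i]) : R[i] :=
  cintegral 0 1 (fun t => cderive z t / (2 * pi%:C * 'i%C * z t)).

End LineIntegral.

Definition maslov_index {R : realType} {V : normedVectType R}
    (omega : {skew_symmetric V}) (J : 'End(V)) (n : nat) (X : {vspace V})
    (e : n.-tuple V) (N : set V) (c : R -> V) : R[i] :=
  winding_integral (fun t => det2 omega J X e (tangent_plane N (c t))).

(* Main.v *)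
(* Along the curve, det^2 of the tangent plane is z = w^2 with w = det Gt, a
   continuous closed curve in the unit circle.  In a chart the tangent planes
   have a C^1 frame v_1, ..., v_n, whose matrix in the Hermitian basis is M = U A
   with U unitary and A real; hence z = det M / conj (det M) is C^1 on each piece
   of the curve.  If Phi is a primitive of the angular speed Im (z' conj z), then
   z exp(-i Phi) is constant, so w exp(-i Phi / 2) is continuous with constant
   square, hence constant.  As w is closed, Phi / 2 increases by 2 k pi along the
   curve, and the integral, which is the increase of Phi / (2 pi), equals 2 k. *)
Require Import Defs.
From HB Require Import structures.
From mathcomp Require Import all_boot all_order all_algebra complex.
From mathcomp Require Import all_classical all_reals all_analysis.
From mathcomp Require Import measurable_realfun ring lra.

Set Implicit Arguments.
Unset Strict Implicit.
Unset Printing Implicit Defensive.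

Import Order.TTheory GRing.Theory Num.Theory numFieldNormedType.Exports.

Local Open Scope classical_set_scope.
Local Open Scope ring_scope.
Local Open Scope complex_scope.

(** * Frames of Lagrangian planes *)

(** The lift [Gt] is only continuous, so w itself has no derivative to integrate: every derivative
    is taken on z, whose regularity comes from the tangent planes alone. The quotient det M / conj
    (det M) makes this possible: the real factor det A cancels and |det U| = 1, so the value does
    not depend on how U is chosen over each plane, and no regular choice of U is needed. Evenness
    comes from the factor 1/2: without w, only the rotation of z through Phi would have to close up,
    which gives an integer; with w, the rotation through Phi / 2 must close up as well. At a break
    point of the curve z need not be differentiable, so each closed piece is treated with
    derivatives at interior points only, and the result for a piece is stated as a rotation of w,
    because rotations compose. Topology and calculus are carried out on real and imaginary parts. *)

Section HermitianFrame.
Context {R : realType} {V : normedVectType R}.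
Variables (omega : {skew_symmetric V}) (J : 'End(V)).
Hypothesis JJ : forall v, J (J v) = - v.
Hypothesis omegaJ : forall u v, omega (J u) (J v) = omega u v.

Local Notation h := (herm omega J).

Lemma herm_is_semilinear w (a : R) u v :
  h (a *: u + v) w = a%:C * h u w + h v w.
Proof.
by rewrite /herm; simpc; rewrite !linearPl /= opprD.
Qed.

Lemma herm_cscale (z : R[i]) v w : h (Defs.cscale J z v) w = z * h v w.
Proof.
case: z => a b; rewrite /herm /Defs.cscale /=; simpc.
rewrite !linearPl /=.
rewrite !linearZl_LR /=.
(* [J] is skew for [omega], because it preserves [omega] and its square is -1. *)
have -> : omega (J v) w = - omega v (J w).
  by rewrite -[in LHS]omegaJ JJ linearNl.
by rewrite omegaJ /=; congr (_ +i* _); ring.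
Qed.

Variables (n : nat) (X : {vspace V}) (e : n.-tuple V).
Hypothesis eX : orthonormal_basis omega J X e.

Definition hcoord (v : V) : 'cV[R[i]]_n := \col_l h v (tnth e l).

Lemma hcoord_semilinear (a : R) u v :
  hcoord (a *: u + v) = a%:C *: hcoord u + hcoord v.
Proof. by apply/colP => l; rewrite !mxE herm_is_semilinear. Qed.

Lemma hcoord0 : hcoord 0 = 0.
Proof.
by have := hcoord_semilinear (-1) 0 0; rewrite scaler0 addr0 rmorphN1 scaleN1r addNr.
Qed.
Lemma hcoordD u v : hcoord (u + v) = hcoord u + hcoord v.
Proof. by rewrite -[u in LHS]scale1r hcoord_semilinear rmorph1 scale1r. Qed.

Lemma hcoordZ (a : R) u : hcoord (a *: u) = a%:C *: hcoord u.
Proof. by rewrite -[a *: u]addr0 hcoord_semilinear hcoord0 addr0. Qed.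

Lemma hcoord_sum (I : Type) (r : seq I) (F : I -> V) :
  hcoord (\sum_(i <- r) F i) = \sum_(i <- r) hcoord (F i).
Proof. exact: (big_morph _ hcoordD hcoord0). Qed.

Lemma hcoord_basis k : hcoord (tnth e k) = delta_mx k 0.
Proof.
case: eX => _ eh; apply/colP => l; rewrite !mxE eh eqxx andbT.
by rewrite eq_sym.
Qed.

Lemma hcoord_unitary_act U v : hcoord (unitary_act omega J e U v) = U *m hcoord v.
Proof.
rewrite /unitary_act hcoord_sum [RHS]matrix_sum_delta.
apply: eq_bigr => k _; rewrite big_ord1.
by rewrite -hcoord_basis; apply/colP => l; rewrite !mxE herm_cscale.
Qed.

Lemma cscaleD z1 z2 v :
  Defs.cscale J (z1 + z2) v = Defs.cscale J z1 v + Defs.cscale J z2 v.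
Proof.
by case: z1 => a b; case: z2 => c d; rewrite /Defs.cscale /= !scalerDl addrACA.
Qed.

Lemma cscaleZ (a : R) z v : Defs.cscale J (a%:C * z) v = a *: Defs.cscale J z v.
Proof.
by case: z => b c; rewrite /Defs.cscale; simpc; rewrite /= scalerDr !scalerA.
Qed.

Lemma unitary_act_linear U : linear (unitary_act omega J e U).
Proof.
move=> a u v; rewrite /unitary_act scaler_sumr -big_split /=.
apply: eq_bigr => k _; rewrite -/(hcoord _) hcoord_semilinear.
by rewrite mulmxDr -scalemxAr [in LHS]mxE [in LHS]mxE cscaleD cscaleZ.
Qed.

Lemma mem_lagr_proj U w : w \in lagr_proj omega J X e U ->
  exists2 x, x \in X & w = unitary_act omega J e U x.
Proof.
pose act := GRing.isLinear.Build _ _ _ _ _ (unitary_act_linear U).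
pose f : {linear V -> V} := HB.pack (unitary_act omega J e U) act.
move=> /memv_imgP[x xX ->]; exists x => //.
by rewrite -[unitary_act _ _ _ _]/(f : V -> V) lfunE.
Qed.

Lemma lagr_proj_mem U x : x \in X ->
  unitary_act omega J e U x \in lagr_proj omega J X e U.
Proof.
pose act := GRing.isLinear.Build _ _ _ _ _ (unitary_act_linear U).
pose f : {linear V -> V} := HB.pack (unitary_act omega J e U) act.
move=> xX; rewrite -[unitary_act _ _ _ _]/(f : V -> V) -lfunE.
exact: memv_img.
Qed.

(** The tuple [e] is both a real basis of [X] and orthonormal for [h], so the real coordinates of a
    vector of [X] are its Hermitian ones. This is how O(n) enters: frames of one plane differ by
    real matrices. *)
Lemma hcoord_real x : x \in X ->
  exists a : 'cV[R]_n, hcoord x = map_mx (real_complex R) a.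
Proof.
move=> xX; case: (eX) => eB _; exists (\col_l coord e l x).
rewrite {1}(coord_basis eB xX) hcoord_sum.
apply/colP => l; rewrite !mxE summxE (bigD1 l)//= big1 => [|k kl].
  by rewrite addr0 hcoordZ -tnth_nth hcoord_basis !mxE !eqxx mulr1.
by rewrite hcoordZ -tnth_nth hcoord_basis !mxE eq_sym (negbTE kl) mulr0.
Qed.

Definition frame_mx (v : 'I_n -> V) : 'M[R[i]]_n :=
  \matrix_(k, j) h (v j) (tnth e k).

Lemma frame_mx_real U (v : 'I_n -> V) :
  (forall j, v j \in lagr_proj omega J X e U) ->
  exists A : 'M[R]_n, frame_mx v = U *m map_mx (real_complex R) A.
Proof.
move=> vU.
have /choice[a aP] : forall j, exists a : 'cV[R]_n,
    hcoord (v j) = U *m map_mx (real_complex R) a.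
  move=> j; have [x xX ->] := mem_lagr_proj (vU j).
  by have [a xa] := hcoord_real xX; exists a; rewrite hcoord_unitary_act xa.
exists (\matrix_(k, j) a j k 0); apply/matrixP => k j.
have /colP/(_ k) := aP j; rewrite !mxE => ->.
by apply: eq_bigr => l _; rewrite !mxE.
Qed.

Lemma det_frame_basis U :
  frame_mx (fun j => unitary_act omega J e U (tnth e j)) = U.
Proof.
apply/matrixP => k j.
have /colP/(_ k) := hcoord_unitary_act U (tnth e j).
rewrite hcoord_basis -colE !mxE => -> //.
Qed.

Lemma det_unitary (U : 'M[R[i]]_n) : U \is unitarymx -> \det U * conjc (\det U) = 1.
Proof.
move=> /unitarymxP/(congr1 determinant).
by rewrite det_mulmx det1 det_map_mx det_tr; apply.
Qed.

(** The frame matrix is [U'] times a real matrix, for whichever unitary [U'] is picked over [L]. The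
    real determinant cancels in the quotient, and det U' / conj (det U') = (det U')^2 since |det U'|
    = 1. *)
Lemma det2_frame U (v : 'I_n -> V) (L := lagr_proj omega J X e U) :
  U \is unitarymx -> (forall j, v j \in L) -> \det (frame_mx v) != 0 ->
  det2 omega J X e L = \det (frame_mx v) / conjc (\det (frame_mx v)).
Proof.
move=> Uu vL D0; rewrite /det2; case: xgetP => [U' _ [U'u U'L]|/(_ U)]; last first.
  by case.
have [|A DA] := @frame_mx_real U' v; first by rewrite U'L.
have dA : \det (map_mx (real_complex R) A) = (\det A)%:C by exact: det_map_mx.
move: D0; rewrite DA det_mulmx dA; set a := \det A.
rewrite mulf_eq0 negb_or => /andP[u0 a0].
rewrite rmorphM /= oppr0 -[a +i* 0]/(a%:C) -mulf_div divff// mulr1.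
have uu := det_unitary U'u.
have c0 : conjc (\det U') != 0 by rewrite conjc_eq0.
by apply: (mulIf c0); rewrite divfK// expr2 -mulrA uu mulr1.
Qed.

End HermitianFrame.

(** * Functions of class C1 near a point *)

Section C1Near.
Context {R : realType}.
Implicit Types (W : normedModType R) (t : R).

(** The condition is imposed on a neighbourhood, so it passes to nearby points, and identities valid
    near [t0] can be differentiated there as well. *)
Definition C1_near {W : normedModType R} (t0 : R) (c : R -> W) : Prop :=
  \forall t \near t0, derivable c t 1 /\ {for t, continuous ('D_1 c)}.

Lemma C1_near_of_derive W t0 (c d : R -> W) :
  (\forall t \near t0, is_derive (t : R) 1 c (d t)) ->
  (\forall t \near t0, {for t, continuous d}) -> C1_near t0 c.
Proof.
move=> /near_join cd dc; near=> t.
have cdt : \forall s \near t, is_derive (s : R) 1 c (d s) by near: t.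
have dt : {for t, continuous d} by near: t.
have [cd1 cd2] := nbhs_singleton cdt.
split => //; rewrite /prop_for /continuous_at cd2.
apply: cvg_trans dt; apply: near_eq_cvg; near=> s.
by have [_ ->] : is_derive (s : R) 1 c (d s) by near: s.
Unshelve. all: by end_near. Qed.

Lemma C1_near_derive W t0 (c : R -> W) : C1_near t0 c ->
  \forall t \near t0, [/\ is_derive (t : R) 1 c ('D_1 c t),
     {for t, continuous ('D_1 c)} & {for t, continuous c}].
Proof.
apply: filterS => t [ct c't]; split; [exact: derivableP | exact: c't |].
exact/differentiable_continuous/derivable1_diffP.
Qed.

Lemma C1_near_cst W t0 (w : W) : C1_near t0 (fun=> w).
Proof.
apply: (@C1_near_of_derive _ _ _ (fun=> 0)); near=> t.
  exact: is_derive_cst.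
exact: cst_continuous.
Unshelve. all: by end_near. Qed.

Lemma C1_nearD W t0 (f g : R -> W) : C1_near t0 f -> C1_near t0 g ->
  C1_near t0 (fun t => f t + g t).
Proof.
move=> /C1_near_derive f1 /C1_near_derive g1.
apply: (@C1_near_of_derive _ _ _ (fun t => 'D_1 f t + 'D_1 g t)).
  by apply: filterS2 f1 g1 => t [df _ _] [dg _ _]; exact: is_deriveD.
by apply: filterS2 f1 g1 => t [_ df _] [_ dg _]; exact: continuousD.
Qed.

Lemma C1_nearM t0 (f g : R -> R) : C1_near t0 f -> C1_near t0 g ->
  C1_near t0 (fun t => f t * g t).
Proof.
move=> /C1_near_derive f1 /C1_near_derive g1.
apply: (@C1_near_of_derive _ _ _ (fun t => f t * 'D_1 g t + g t * 'D_1 f t)).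
  by apply: filterS2 f1 g1 => t [df _ _] [dg _ _]; exact: is_deriveM.
apply: filterS2 f1 g1 => t [_ df cf] [_ dg cg].
exact: cvgD (cvgM cf dg) (cvgM cg df).
Qed.

Lemma C1_nearV t0 (f : R -> R) : f t0 != 0 -> C1_near t0 f ->
  C1_near t0 (fun t => (f t)^-1).
Proof.
move=> f0 /C1_near_derive f1.
have fN0 : \forall t \near t0, f t != 0.
  have [_ _ c] := nbhs_singleton f1.
  by apply: (c [set x | x != 0]); exact: (open_nbhs_nbhs (conj (@open_neq R 0) f0)).
pose d t := - (f t) ^- 2 *: ('D_1 f t : R).
apply: (@C1_near_of_derive _ _ _ d).
  apply: filterS2 f1 fN0 => t [df _ _] ft.
  by apply: DeriveDef; [exact: derivableV | rewrite deriveV// derive_val].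
apply: filterS2 f1 fN0 => t [_ df c] ft.
apply: cvgM df; apply: cvgN; apply: cvgV; first by rewrite expf_neq0.
exact: (cvgM c c).
Qed.

End C1Near.

Section ComplexClosure.
Context {R : realType} {T : Type} (P : (T -> R) -> Prop).
Hypothesis Pcst : forall a, P (fun=> a).
Hypothesis PD : forall f g, P f -> P g -> P (fun t => f t + g t).
Hypothesis PM : forall f g, P f -> P g -> P (fun t => f t * g t).

(** [P] stays abstract because the closure of [P] under determinants, which are polynomials in the
    entries, serves twice: for functions that are [C1_near] a point and for functions continuous
    within a set. *)
Definition on_Re_Im (z : T -> R[i]) : Prop :=
  P (fun t => complex.Re (z t)) /\ P (fun t => complex.Im (z t)).

Lemma on_Re_Im_cst a : on_Re_Im (fun=> a).
Proof. by split; exact: Pcst. Qed.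

Lemma on_Re_ImD z w : on_Re_Im z -> on_Re_Im w -> on_Re_Im (fun t => z t + w t).
Proof.
move=> [zR zI] [wR wI]; split; [move: (PD zR wR) | move: (PD zI wI)];
by congr P; apply/funext => t; case: (z t) (w t) => [a b] [].
Qed.

Lemma on_Re_ImM z w : on_Re_Im z -> on_Re_Im w -> on_Re_Im (fun t => z t * w t).
Proof.
move=> [zR zI] [wR wI]; split.
  have := PD (PM zR wR) (PM (Pcst (-1)) (PM zI wI)).
  by congr P; apply/funext => t; case: (z t) (w t) => [a b] []//= c d; rewrite mulN1r.
have := PD (PM zR wI) (PM zI wR).
by congr P; apply/funext => t; case: (z t) (w t) => [a b] [].
Qed.

Lemma on_Re_Im_sum (I : Type) (r : seq I) (F : I -> T -> R[i]) :
  (forall i, on_Re_Im (F i)) -> on_Re_Im (fun t => \sum_(i <- r) F i t).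
Proof.
move=> FP; elim: r => [|i r IH].
  by under eq_fun do rewrite big_nil; exact: on_Re_Im_cst.
by under eq_fun do rewrite big_cons; exact: on_Re_ImD.
Qed.

Lemma on_Re_Im_prod (I : Type) (r : seq I) (F : I -> T -> R[i]) :
  (forall i, on_Re_Im (F i)) -> on_Re_Im (fun t => \prod_(i <- r) F i t).
Proof.
move=> FP; elim: r => [|i r IH].
  by under eq_fun do rewrite big_nil; exact: on_Re_Im_cst.
by under eq_fun do rewrite big_cons; exact: on_Re_ImM.
Qed.

Lemma on_Re_Im_det n (M : T -> 'M[R[i]]_n) :
  (forall i j, on_Re_Im (fun t => M t i j)) -> on_Re_Im (fun t => \det (M t)).
Proof.
move=> PMij; apply: on_Re_Im_sum => s; apply: on_Re_ImM.
  exact: on_Re_Im_cst.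
exact: on_Re_Im_prod.
Qed.

End ComplexClosure.

(** * Finite-dimensional normed spaces *)

Section FiniteDimension.
Context {R : realType} {V : normedVectType R}.

Local Notation b := (vbasis {:V}).

Lemma cvg_sum_seq (T I : Type) (W : normedModType R) (F : set_system T)
    {FF : Filter F} (r : seq I) (f : I -> T -> W) (l : I -> W) :
  (forall i, f i t @[t --> F] --> l i) ->
  \sum_(i <- r) f i t @[t --> F] --> \sum_(i <- r) l i.
Proof.
move=> fl; elim: r => [|i r IH].
  rewrite big_nil; under eq_fun do rewrite big_nil.
  exact: cvg_cst.
rewrite big_cons; under eq_fun do rewrite big_cons.
by apply: cvgD.
Qed.

(* The constant is the minimum of the norm on the unit sphere of the coordinate
   space, which is compact. *)
Lemma coord_vbasis_lipschitz :
  exists2 m : R, 0 < m & forall i v, m * `|coord b i v| <= `|v|.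
Proof.
pose d := \dim {:V}.
pose psi (x : 'rV[R]_d) : V := \sum_i x 0 i *: b`_i.
have psiZ (a : R) x : psi (a *: x) = a *: psi x.
  by rewrite /psi scaler_sumr; apply: eq_bigr => i _; rewrite mxE scalerA.
have psiE v : v = psi (\row_i coord b i v).
  rewrite {1}(coord_vbasis (memvf v)).
  by apply: eq_bigr => i _; rewrite mxE.
have psi_coord x i : coord b i (psi x) = x 0 i.
  by rewrite coord_sum_free// (basis_free (vbasisP _)).
have psi_cont0 : continuous psi.
  move=> x; apply: (@cvg_sum_seq _ _ V (nbhs x) _ _ (fun i x => x 0 i *: b`_i)).
  by move=> i; apply: cvgZr_tmp; exact: (@coord_continuous R 1 d 0 i x).
have psi_cont : continuous (fun x => `|psi x| : R).
  by move=> x; apply: (continuous_comp (psi_cont0 x)); exact: norm_continuous.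
have le_coord (x : 'rV[R]_d) i : `|x 0 i| <= `|x|.
  rewrite [leRHS]/Num.norm /= mx_normrE; apply/bigmax_geP; right => /=.
  by exists (0, i).
pose S := [set x : 'rV[R]_d | `|x| = 1].
have cS : compact S.
  apply: bounded_closed_compact.
    by exists 1; split => // M M1 x Sx; rewrite /= Sx ltW.
  have -> : S = (fun x => `|x|) @^-1` [set 1] by [].
  apply: closed_comp; last exact: closed_eq.
  by move=> x _; exact: norm_continuous.
(* The sphere is empty only in dimension 0; an index [i] would give a nonzero vector to normalise,
   so there is none and any constant works. *)
have [S0|Sn0] := eqVneq S set0.
  exists 1 => // i v; exfalso.
  pose x : 'rV[R]_d := delta_mx 0 i.
  have x0 : `|x| != 0.
    rewrite normr_eq0; apply/eqP => /rowP/(_ i).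
    by rewrite !mxE !eqxx => /eqP; rewrite oner_eq0.
  have : S (`|x|^-1 *: x) by rewrite /S /= normrZ normfV normr_id mulVf.
  by rewrite S0.
have /set0P Sx0 := Sn0.
have [c cS' cmin] := EVT_min_rV Sx0 cS (continuous_subspaceT psi_cont).
exists `|psi c|.
  rewrite normr_gt0; apply/eqP => pc0.
  have c0 : c = 0 by apply/rowP => i; rewrite -psi_coord pc0 linear0 mxE.
  by move: cS'; rewrite c0 inE /S /= normr0 => /eqP; rewrite eq_sym oner_eq0.
move=> i v; set x := \row_i coord b i v.
have -> : coord b i v = x 0 i by rewrite mxE.
rewrite (psiE v) -/x.
have [->|x0] := eqVneq x 0.
  by rewrite mxE normr0 mulr0.
have nx : 0 < `|x| by rewrite normr_gt0.
have /cmin : `|x|^-1 *: x \in S.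
  by rewrite inE /S /= normrZ normfV normr_id mulVf ?gt_eqF.
rewrite psiZ normrZ normfV normr_id ler_pdivlMl// => H.
by apply: le_trans H; rewrite mulrC ler_wpM2r.
Qed.

Lemma coord_vbasis_continuous i : continuous (coord b i : V -> R).
Proof.
have [m m0 H] := coord_vbasis_lipschitz.
apply: (@bounded_linear_continuous _ _ _ (coord b i : {linear V -> R})).
apply/linear_boundedP; exists m^-1; split; first exact: num_real.
move=> r mr x; apply: (@le_trans _ _ (m^-1 * `|x|)).
  rewrite ler_pdivlMl//; exact: H.
by rewrite ler_wpM2r// ltW.
Qed.

Lemma findim_linear_continuous (W : normedModType R) (f : {linear V -> W}) :
  continuous f.
Proof.
have -> : (f : V -> W) = fun v => \sum_i coord b i v *: f b`_i.
  apply/funext => v; rewrite {1}(coord_vbasis (memvf v)) linear_sum.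
  by apply: eq_bigr => i _; rewrite linearZ.
move=> x; apply: cvg_sum_seq => i; apply: cvgZr_tmp.
exact: coord_vbasis_continuous.
Qed.

End FiniteDimension.

(** * Curves in submanifolds *)

Section CurveComposition.
Context {R : realType} {V : normedVectType R}.

Lemma is_derive_comp_curve (U W : normedModType R) (F : U -> W) (c : R -> U) (t : R) :
  derivable c t 1 -> differentiable F (c t) ->
  is_derive t 1 (F \o c) ('D_('D_1 c t) F (c t)).
Proof.
move=> /derivable1_diffP dc dF.
have dFc : differentiable (F \o c) t by exact: differentiable_comp.
apply: DeriveDef; first exact/derivable1_diffP.
by rewrite !deriveE// diff_comp.
Qed.

Lemma derive_sum_vbasis (W : normedModType R) (F : V -> W) (x v : V) :
  differentiable F x ->
  'D_v F x = \sum_i coord (vbasis {:V}) i v *: 'D_((vbasis {:V})`_i) F x.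
Proof.
move=> dF; rewrite deriveE// {1}(coord_vbasis (memvf v)) linear_sum.
by apply: eq_bigr => i _; rewrite linearZ deriveE.
Qed.

(** [Ck_on] gives continuity of directional derivatives in fixed directions only, whereas the
    direction ['D_1 c t] moves with [t]. It is expanded in a basis of [V], where its coordinates are
    continuous. *)
Lemma C1_near_comp (W : normedModType R) (A : set V) (F : V -> W) (c : R -> V)
    (t0 : R) :
  open A -> Ck_on 1 A F -> A (c t0) -> C1_near t0 c -> C1_near t0 (F \o c).
Proof.
move=> oA [dF cF] Ac /C1_near_derive c1.
have Anear : \forall t \near t0, A (c t).
  have [_ _ ct0] := nbhs_singleton c1.
  by apply: (ct0 A); exact: open_nbhs_nbhs.
apply: (@C1_near_of_derive _ _ _ _ (fun t => 'D_('D_1 c t) F (c t))).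
  apply: filterS2 c1 Anear => t [[ct _] _ _] At.
  by apply: is_derive_comp_curve => //; exact: dF.
pose b := vbasis {:V}.
have /near_join dE : \forall t \near t0,
    \sum_i coord b i ('D_1 c t) *: 'D_(b`_i) F (c t) = 'D_('D_1 c t) F (c t).
  by apply: filterS Anear => t At; rewrite -derive_sum_vbasis//; exact: dF.
apply: filterS3 c1 Anear dE => t [_ c't ct] At Et.
rewrite /prop_for /continuous_at -(nbhs_singleton Et).
apply: cvg_trans (near_eq_cvg Et) _.
apply: cvg_sum_seq => i; apply: cvgZ.
  exact: (continuous_comp c't (@coord_vbasis_continuous _ _ _ _)).
exact: (continuous_comp ct (cF _ _ At)).
Qed.

End CurveComposition.

Section TangentPlane.
Context {R : realType} {V : normedVectType R}.

(** The two difference quotients are the same function, so no differentiability is required; this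
    allows induction on the order in [Ck_on_affine]. *)
Lemma derive_affine (W : normedModType R) (g : V -> W) (y u : V) (v : R) :
  'D_v (fun t : R => g (y + t *: u)) = (fun t => 'D_(v *: u) g (y + t *: u)).
Proof.
apply/funext => t; rewrite /derive; set h1 := (fun h => _); set h2 := (fun h => _).
suff -> : h1 = h2 by [].
apply/funext => k; rewrite /h1 /h2 /=; congr (_ *: (g _ - _)).
by rewrite scalerDl addrCA scalerA.
Qed.

Lemma Ck_on_affine k (W : normedModType R) (B : set V) (g : V -> W) (y u : V) :
  Ck_on k B g -> Ck_on k [set t : R | B (y + t *: u)] (fun t : R => g (y + t *: u)).
Proof.
have daff (t : R) : differentiable (fun t : R => y + t *: u) t.
  by apply: differentiableD => //; exact: differentiableZl.
elim: k g => [|k IH] g /=.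
  move=> gB t Bt.
  exact: (continuous_comp (differentiable_continuous (daff t)) (gB _ Bt)).
move=> [dg cg]; split=> [t Bt|v].
  by apply: (differentiable_comp (daff t)); exact: dg.
by rewrite derive_affine; exact: (IH ('D_(v *: u) g) (cg _)).
Qed.

(** The complementary projection [p] kills [h] near [t], hence by the chain rule kills its
    derivative. *)
Lemma derive_in_subspace (E : {vspace V}) (h : R -> V) (t : R) :
  derivable h t 1 -> (\forall s \near t, h s \in E) -> 'D_1 h t \in E.
Proof.
move=> dh hE.
pose p : 'End(V) := (\1%VF - projv E)%R.
have pE v : p v = v - projv E v by rewrite /p !lfunE /= lfunE /= lfunE.
have := @is_derive_comp_curve _ _ _ p h t dh.
have pc : continuous p by exact: findim_linear_continuous.
move=> /(_ (linear_differentiable _ pc)) [_ dp].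
rewrite [RHS]deriveE in dp; last exact: (linear_differentiable _ pc).
rewrite diff_lin// -[RHS]/(p _) pE in dp.
have : 'D_1 (p \o h) t = 'D_1 (cst 0) t.
  apply: near_eq_derive; apply: filterS hE => s hs /=.
  by rewrite pE projv_id// subrr.
rewrite dp derive_cst => /eqP; rewrite subr_eq0 => /eqP ->.
exact: memv_proj.
Qed.

Variables (N A B : set V) (f g : V -> V) (E : {vspace V}).
Hypotheses (oA : open A) (oB : open B) (fg : diffeomorphism A B f g).
Hypothesis chart : forall y, A y -> (N y <-> f y \in E).

(** Chain rule for g o f, which is the identity on the open set [A]. *)
Lemma derive_chartK x w : A x -> 'D_('D_w f x) g (f x) = w.
Proof.
move=> Ax; case: fg => sf sg fK gK.
have df : differentiable f x by exact: (sf 1%N).1.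
have dg : differentiable g (f x) by apply: (sg 1%N).1; exact: (fK _ Ax).1.
rewrite deriveE// deriveE//.
rewrite -[LHS]/(('d g (f x) \o 'd f x) w) -diff_comp// -deriveE; last first.
  exact: differentiable_comp.
rewrite (@near_eq_derive _ _ _ _ id) ?derive_id//.
near=> y; apply: (fK y _).2; near: y.
exact: open_nbhs_nbhs.
Unshelve. all: by end_near. Qed.

(** A curve in [N] is sent by [f] into [E] near time 0, so its velocity is sent into [E].
    Conversely, [g] maps a straight line through [f x] directed by [u] to a curve in [N] with
    velocity ['D_u g (f x)]. *)
Lemma velocities_chart x : A x -> N x ->
  velocities N x = [set 'D_u g (f x) | u in [set u | u \in E]].
Proof.
move=> Ax Nx; case: (fg) => sf sg fK gK.
apply/seteqP; split=> [v [I [c [[oI I0] sc cN c0 <-]]]|_ [u /= uE <-]].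
  have dc : derivable c 0 1 by apply/derivable1_diffP; exact: (sc 1%N).1.
  have cc : {for 0, continuous c} by exact/differentiable_continuous/derivable1_diffP.
  exists ('D_(derive1 c 0) f x); last by rewrite derive_chartK.
  have df : differentiable f (c 0) by rewrite c0; exact: (sf 1%N).1.
  have [dfc] := is_derive_comp_curve dc df.
  rewrite c0 -(derive1E c) => <-.
  apply: derive_in_subspace => //; near=> s.
  have As : A (c s).
    by near: s; apply: (cc A); rewrite c0; exact: open_nbhs_nbhs.
  by apply/(chart As)/cN; near: s; exact: open_nbhs_nbhs.
exists [set t | B (f x + t *: u)], (fun t => g (f x + t *: u)).
have cts : continuous (fun t : R => f x + t *: u).
  by move=> t; apply: cvgD; [exact: cvg_cst|apply: cvgZr_tmp; exact: cvg_id].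
split.
- split; first by move: cts => /continuousP; exact.
  by rewrite /= scale0r addr0; exact: (fK _ Ax).1.
- by move=> k; exact: Ck_on_affine.
- move=> t /gK [Ag fgt]; apply/(chart Ag); rewrite fgt rpredD ?rpredZ//.
  exact/chart.
- by rewrite scale0r addr0; exact: (fK _ Ax).2.
- rewrite derive1E -[LHS]/(('D_1 (fun t : R => g (f x + t *: u))) 0) derive_affine.
  by rewrite scale0r addr0 scale1r.
Unshelve. all: by end_near. Qed.

Lemma mem_tangent_plane_chart x w : A x -> N x ->
  (w \in tangent_plane N x) <-> exists2 u, u \in E & w = 'D_u g (f x).
Proof.
move=> Ax Nx; case: (fg) => sf sg fK gK.
have dg : differentiable g (f x) by apply: (sg 1%N).1; exact: (fK _ Ax).1.
rewrite /tangent_plane; case: xgetP => [T _ /= TE|].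
  split=> [wT|[u uE ->]].
    have : [set v | v \in T] w by [].
    by rewrite TE velocities_chart// => -[u uE <-]; exists u.
  have : velocities N x ('D_u g (f x)) by rewrite velocities_chart//; exists u.
  by rewrite -TE.
(* The image of [E] under the differential of [g] is a subspace equal to the set of velocities, so
   the default [0%VS] is ruled out. *)
move=> /(_ (linfun ('d g (f x)) @: E)%VS) []; rewrite velocities_chart//.
apply/seteqP; split=> [_ /= /memv_imgP[u uE ->]|_ [u /= uE <-]].
  by exists u => //; rewrite deriveE// lfunE.
by rewrite deriveE// -[X in X \in _]lfunE memv_img.
Qed.

End TangentPlane.

(** * Integrals over adjacent intervals *)

Section IntervalIntegral.
Context {R : realType}.
Local Notation mu := (@lebesgue_measure R).

(* The integrand of the Maslov index takes junk values at the break points of the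
   curve, where it need not be differentiable; only open pieces matter. *)
Lemma Rintegral_eq_oo (f g : R -> R) (a b : R) :
  mu.-integrable `[a, b] (EFin \o g) -> {in `]a, b[, f =1 g} ->
  mu.-integrable `[a, b] (EFin \o f) /\
  \int[mu]_(t in `[a, b]) f t = \int[mu]_(t in `[a, b]) g t.
Proof.
move=> ig fg.
have ig' : mu.-integrable `]a, b[ (EFin \o g).
  by apply: integrableS ig => //; exact: subset_itv_oo_cc.
have if' : mu.-integrable `]a, b[ (EFin \o f).
  apply: eq_integrable ig' => // t; rewrite inE /= => tab.
  by rewrite fg.
have mf : measurable_fun `[a, b] f.
  apply/measurable_fun_itv_bndo_bndcP/measurable_fun_itv_obnd_cbndP.
  by apply/measurable_EFinP; exact: measurable_int if'.
have mgab : measurable_fun `[a, b] g.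
  by apply/measurable_EFinP; exact: measurable_int ig.
pose N := [set a] `|` [set b] : set R.
have mN : measurable N by apply: measurableU.
have N0 : mu N = 0%E.
  apply/eqP; rewrite eq_le measure_ge0 andbT.
  by rewrite (le_trans (measureU2 _ _ _))//= !lebesgue_measure_set1 adde0.
have DN : `[a, b] `\` N = `]a, b[%classic.
  rewrite /N; apply/seteqP; split=> t; rewrite /= !in_itv /=.
    move=> [/andP[at_ tb] /not_orP[/eqP ta /eqP tb']].
    by rewrite !lt_neqAle at_ tb eq_sym ta tb'.
  move=> /andP[at_ tb]; split; first by rewrite !ltW.
  by move=> [] /= E; [move: at_|move: tb]; rewrite E ltxx.
have iff : mu.-integrable `[a, b] (EFin \o f).
  have mEf : measurable_fun `[a, b] (EFin \o f) by exact/measurable_EFinP.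
  by apply/(@negligible_integrable _ _ _ mu _ N) => //; rewrite DN.
split => //; rewrite /Rintegral.
rewrite [in LHS](@negligible_integral _ _ _ mu _ N)//.
rewrite [in RHS](@negligible_integral _ _ _ mu _ N)// DN.
by congr fine; apply: eq_integral => t; rewrite inE /= => tab; rewrite /= fg.
Qed.

(** Integrability is part of the conclusion because pieces are glued by induction. The point [b] is
    removed from the second interval to get a disjoint union, which does not change the integral. *)
Lemma Rintegral_cat (f : R -> R) (a b c : R) : a <= b -> b <= c ->
  mu.-integrable `[a, b] (EFin \o f) -> mu.-integrable `[b, c] (EFin \o f) ->
  mu.-integrable `[a, c] (EFin \o f) /\
  \int[mu]_(t in `[a, c]) f t =
    \int[mu]_(t in `[a, b]) f t + \int[mu]_(t in `[b, c]) f t.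
Proof.
move=> ab bc iab ibc.
have ibc' : mu.-integrable `]b, c] (EFin \o f).
  by apply: integrableS ibc => //; exact: subset_itv_oc_cc.
have acE : `[a, c]%classic = `[a, b] `|` `]b, c].
  by rewrite -itv_bndbnd_setU// bnd_simp.
have disj : [disjoint `[a, b]%classic & `]b, c]%classic].
  apply/disj_setPS => y [/=]; rewrite !in_itv/= => /andP[_ yx] /andP[].
  by rewrite ltNge yx.
have iac : mu.-integrable `[a, c] (EFin \o f).
  apply/(@integrable_mkcond _ _ _ mu _ (EFin \o f)) => //.
  rewrite acE.
  have -> : (EFin \o f) \_ (`[a, b] `|` `]b, c]) =
      ((EFin \o f) \_ `[a, b] \+ (EFin \o f) \_ `]b, c])%E.
    apply/funext => t /=; rewrite !patchE in_setU.
    have [tab|] := boolP (t \in `[a, b]%classic); last by rewrite add0e.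
    have [tbc|] := boolP (t \in `]b, c]%classic); last by rewrite adde0.
    exfalso; move/disj_setPS: disj => /(_ t); apply.
    by split; [move: tab | move: tbc]; rewrite inE.
  by apply: integrableD => //; apply/(@integrable_mkcond _ _ _ mu _ (EFin \o f)).
split => //; rewrite acE Rintegral_setU//; last by rewrite -acE.
by rewrite Rintegral_itv_obnd_cbnd.
Qed.

End IntervalIntegral.

(** * Continuity of determinants *)

Section ComplexContinuity.
Context {R : realType}.

Lemma Re_continuous : continuous (@complex.Re R : R[i]^o -> R).
Proof.
move=> z; apply/(@cvgrPdist_lt _ _ _ (nbhs (z : R[i]^o)) _) => eps e0.
have : nbhs (z : R[i]^o) (ball (z : R[i]^o) eps%:C).
  by apply: nbhsx_ballx; rewrite ltcR.
apply: filterS => -[c d]; rewrite -ball_normE /=; case: z => a b.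
rewrite normc_def /= ltcR; apply: le_lt_trans.
rewrite -sqrtr_sqr ler_sqrt ?lerDl ?sqr_ge0//.
by rewrite addr_ge0 ?sqr_ge0.
Qed.

Lemma Im_continuous : continuous (@complex.Im R : R[i]^o -> R).
Proof.
move=> z; apply/(@cvgrPdist_lt _ _ _ (nbhs (z : R[i]^o)) _) => eps e0.
have : nbhs (z : R[i]^o) (ball (z : R[i]^o) eps%:C).
  by apply: nbhsx_ballx; rewrite ltcR.
apply: filterS => -[c d]; rewrite -ball_normE /=; case: z => a b.
rewrite normc_def /= ltcR; apply: le_lt_trans.
rewrite -sqrtr_sqr ler_sqrt ?lerDr ?sqr_ge0//.
by rewrite addr_ge0 ?sqr_ge0.
Qed.

Lemma within_continuous_det (n : nat) (A : set R) (G : R -> 'M[R[i]^o]_n) :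
  {within A, continuous G} ->
  on_Re_Im (fun h : R -> R => {within A, continuous h})
    (fun t => \det (G t : 'M[R[i]]_n)).
Proof.
move=> cG; apply: on_Re_Im_det => [a|f g cf cg|f g cf cg|i j].
- by move=> t; exact: cvg_cst.
- by move=> t; apply: cvgD; [exact: cf|exact: cg].
- by move=> t; apply: cvgM; [exact: cf|exact: cg].
have cij : {within A, continuous (fun t => G t i j : R[i]^o)}.
  by move=> t; exact: (continuous_comp (cG t) (@coord_continuous R[i] n n i j (G t))).
split=> t; apply: (continuous_comp (cij t)); first exact: Re_continuous.
exact: Im_continuous.
Qed.

End ComplexContinuity.

(** * Winding of the square of a unit curve *)

Section Lifting.
Context {R : realType}.
Local Notation mu := (@lebesgue_measure R).

(** Reduce to [y] in [0, 2 pi). Then cos y = 1 forces sin (y / 2) = 0 by the double angle formula,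
    while sin is positive on (0, pi). *)
Lemma cos_eq1 (x : R) : cos x = 1 -> exists k : int, x = (2 * pi) * k%:~R.
Proof.
have pi2 : 0 < 2 * pi :> R by rewrite mulr_gt0// pi_gt0.
wlog x0 : x / 0 <= x => [H|].
  have [/H//|/ltW xle0] := leP 0 x.
  rewrite -cosN => /H[|k xk]; first by rewrite oppr_ge0.
  by exists (- k); rewrite mulrNz mulrN -xk opprK.
move=> cx; pose k := Num.truncn (x / (2 * pi)).
have /andP[kx xk] := Num.Theory.truncn_itv (divr_ge0 x0 (ltW pi2)).
rewrite -/k ler_pdivlMr// in kx; rewrite -/k ltr_pdivrMr// in xk.
exists k; set y := x - (2 * pi) * k%:R.
have xy : x = y + (pi *+ 2) *+ k by rewrite -[_ *+ k]mulr_natr -(mulr_natl pi) /y subrK.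
have cy : cos y = 1 by rewrite -cx xy periodicn//; exact: cosD2pi.
have sy : sin (y / 2) = 0.
  have := cosD (y / 2) (y / 2); rewrite -splitr cy.
  have := cos2Dsin2 (y / 2) => H1 H2.
  by apply/eqP; rewrite -sqrf_eq0; apply/eqP; nra.
have [y0|y0] := eqVneq y 0; first by apply/eqP; rewrite -subr_eq0 -/y y0.
have : 0 < sin (y / 2).
  have y_gt0 : 0 < y by rewrite lt_def y0 subr_ge0 mulrC.
  have y_lt : y < 2 * pi by rewrite ltrBlDr -{1}[2 * pi]mulr1 -mulrDr nat1r mulrC.
  by apply: sin_gt0_pi; rewrite divr_gt0//= ltr_pdivrMr// mulrC.
by rewrite sy ltxx.
Qed.

(** If [u b] were [- u a], then [u] would vanish somewhere in between, and the constant square would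
    be 0. *)
Lemma within_continuous_sqr_cst (u : R -> R) (a b : R) : a <= b ->
  {within `[a, b], continuous u} ->
  (forall t, t \in `[a, b] -> u t ^+ 2 = u a ^+ 2) -> u b = u a.
Proof.
move=> ab cu u2.
have bab : b \in `[a, b] by rewrite in_itv /= ab lexx.
have := u2 _ bab => /eqP; rewrite eqf_sqr => /orP[/eqP//|/eqP ub].
have [c cab uc] : exists2 c, c \in `[a, b] & u c = 0.
  apply: IVT => //; rewrite ub ge_min le_max oppr_le0 oppr_ge0.
  by have [_|/ltW ->] := leP (u a) 0; rewrite ?orbT.
have := u2 _ cab; rewrite uc expr0n /= => /esym/eqP; rewrite sqrf_eq0 => /eqP ua.
by rewrite ub ua oppr0.
Qed.

Lemma derive0_cst (u : R -> R) (a b : R) : a <= b ->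
  {within `[a, b], continuous u} ->
  (forall t, t \in `]a, b[ -> is_derive t 1 u 0) ->
  forall t, t \in `[a, b] -> u t = u a.
Proof.
move=> ab cu du t; rewrite in_itv /= => /andP[at_ tb].
have sub (s : R) : s \in `]a, t[ -> is_derive s 1 u 0.
  rewrite in_itv /= => /andP[as_ st]; apply: du.
  by rewrite in_itv /= as_ (lt_le_trans st tb).
have [|c _] := MVT_segment at_ (df := fun=> 0) sub.
  apply: continuous_subspaceW cu => s /=; rewrite !in_itv /= => /andP[-> st].
  exact: le_trans tb.
by rewrite mul0r => /eqP; rewrite subr_eq0 => /eqP.
Qed.

Variables (a b : R) (x y : R -> R).
Hypotheses (ab : a < b).
Hypotheses (cx : {within `[a, b], continuous x}) (cy : {within `[a, b], continuous y}).
Hypothesis xy1 : forall t, t \in `[a, b] -> x t ^+ 2 + y t ^+ 2 = 1.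

(** Real and imaginary parts of z = w^2 for w = x + i y. Only these are assumed C^1, and only on
    [[a, b]], through local functions that extend past the endpoints. *)
Let p t := x t ^+ 2 - y t ^+ 2.
Let r t := 2 * (x t * y t).

Hypothesis pr_C1 : forall t0, t0 \in `[a, b] -> exists ph rh : R -> R,
  [/\ C1_near t0 ph, C1_near t0 rh &
      \forall t \near t0, t \in `[a, b] -> p t = ph t /\ r t = rh t].

Let q t := 'D_1 r t * p t - 'D_1 p t * r t.

Lemma itv_oo_cc_mem (t : R) : t \in `]a, b[ -> t \in `[a, b].
Proof. by rewrite !in_itv /= => /andP[/ltW -> /ltW ->]. Qed.

Lemma pr_is_derive t : t \in `]a, b[ ->
  is_derive t 1 p ('D_1 p t) /\ is_derive t 1 r ('D_1 r t).
Proof.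
move=> tab; have [ph [rh [ph1 rh1 E]]] := pr_C1 (itv_oo_cc_mem tab).
have [ph' _ _] := nbhs_singleton (C1_near_derive ph1).
have [rh' _ _] := nbhs_singleton (C1_near_derive rh1).
have nab := near_in_itvoo tab.
split; apply: derivableP; [apply: (@near_eq_derivable _ _ _ ph)
                          |apply: (@near_eq_derivable _ _ _ rh)] => //.
- by apply: filterS2 E nab => s Es /itv_oo_cc_mem/Es[-> _].
- by apply: filterS2 E nab => s Es /itv_oo_cc_mem/Es[_ ->].
Qed.

(** At an endpoint the two-sided derivatives in [q] carry no information, so [q] is compared with a
    continuous function at interior points only. *)
Lemma angular_speed_local t0 : t0 \in `[a, b] ->
  exists2 qh : R -> R, {for t0, continuous qh} &
  \forall t \near t0, t \in `]a, b[ -> q t = qh t.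
Proof.
move=> t0ab; have [ph [rh [ph1 rh1 E]]] := pr_C1 t0ab.
exists (fun t => 'D_1 rh t * ph t - 'D_1 ph t * rh t).
  have [_ ph' phc] := nbhs_singleton (C1_near_derive ph1).
  have [_ rh' rhc] := nbhs_singleton (C1_near_derive rh1).
  exact: cvgB (cvgM rh' phc) (cvgM ph' rhc).
move/near_join: E; apply: filterS => t E tab.
have nE : \forall s \near t, p s = ph s /\ r s = rh s.
  by apply: filterS2 E (near_in_itvoo tab) => s Es /itv_oo_cc_mem/Es.
rewrite /q; have [-> ->] := nbhs_singleton nE.
rewrite (@near_eq_derive _ _ _ p ph) 1?(@near_eq_derive _ _ _ r rh)//.
  by apply: filterS nE => s [].
by apply: filterS nE => s [].
Qed.

(** Supplies a continuous integrand on the closed interval, as the fundamental theorem of calculus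
    needs; the endpoint values come from the local comparison functions. *)
Lemma angular_speed_extension : exists2 Q : R -> R, {within `[a, b], continuous Q} &
  {in `]a, b[, Q =1 q}.
Proof.
have [qa qac qaE] : exists2 qh : R -> R, {for a, continuous qh} &
    \forall t \near a, t \in `]a, b[ -> q t = qh t.
  by apply: angular_speed_local; rewrite in_itv /= lexx ltW.
have [qb qbc qbE] : exists2 qh : R -> R, {for b, continuous qh} &
    \forall t \near b, t \in `]a, b[ -> q t = qh t.
  by apply: angular_speed_local; rewrite in_itv /= lexx ltW.
pose Q t := if t <= a then qa a else if b <= t then qb b else q t.
have QE : {in `]a, b[, Q =1 q}.
  by move=> t; rewrite in_itv /= /Q => /andP[at_ tb]; rewrite leNgt at_ /= leNgt tb.
exists Q => //; apply/continuous_within_itvP => //; split.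
- move=> t tab; have [qh qhc qhE] := angular_speed_local (itv_oo_cc_mem tab).
  have E : \forall s \near t, qh s = Q s.
    by apply: filterS2 qhE (near_in_itvoo tab) => s qs sab; rewrite QE// qs.
  rewrite /prop_for /continuous_at -(nbhs_singleton E).
  exact: cvg_trans (near_eq_cvg E) qhc.
- have -> : Q a = qa a by rewrite /Q lexx.
  apply: cvg_trans (cvg_at_right_filter qac); apply: near_eq_cvg; near=> s.
  have sab : s \in `]a, b[ by rewrite in_itv /=; apply/andP; split.
  rewrite QE//; apply/esym; move: sab; near: s.
  exact: cvg_within.
- have -> : Q b = qb b by rewrite /Q leNgt ab /= lexx.
  apply: cvg_trans (cvg_at_left_filter qbc); apply: near_eq_cvg; near=> s.
  have sab : s \in `]a, b[ by rewrite in_itv /=; apply/andP; split.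
  rewrite QE//; apply/esym; move: sab; near: s.
  exact: cvg_within.
Unshelve. all: by end_near. Qed.

Lemma pr_unit t : t \in `[a, b] -> p t ^+ 2 + r t ^+ 2 = 1.
Proof. 
move=> /xy1 E; have -> : p t ^+ 2 + r t ^+ 2 = (x t ^+ 2 + y t ^+ 2) ^+ 2.
  by rewrite /p /r; ring.
by rewrite E expr1n.
Qed.

Lemma pr_orthogonal t : t \in `]a, b[ -> p t * 'D_1 p t + r t * 'D_1 r t = 0.
Proof.
move=> tab; have [dp dr] := pr_is_derive tab.
have d : is_derive t 1 (p * p + r * r)
    ((p t *: 'D_1 p t + p t *: 'D_1 p t) + (r t *: 'D_1 r t + r t *: 'D_1 r t)).
  by apply: is_deriveD.
have : 'D_1 (p * p + r * r) t = 'D_1 (cst (1 : R) : R -> R) t.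
  apply: near_eq_derive; apply: filterS (near_in_itvoo tab) => s sab.
  exact: (pr_unit (itv_oo_cc_mem sab)).
rewrite derive_val derive_cst => /= E.
have E' : p t * 'D_1 p t + p t * 'D_1 p t +
  (r t * 'D_1 r t + r t * 'D_1 r t) = 0 by exact: E.
lra.
Qed.

(** Here [th] is [Phi b / 2]. Expressing the conclusion as a rotation avoids choosing an argument of
    w. *)
Lemma lift_rotation : exists Q th,
  [/\ {within `[a, b], continuous Q}, {in `]a, b[, Q =1 q},
      \int[mu]_(t in `[a, b]) Q t = 2 * th
    & x b = x a * cos th - y a * sin th /\ y b = x a * sin th + y a * cos th].
Proof.
have [Q cQ QE] := angular_speed_extension.
have iQ : mu.-integrable `[a, b] (EFin \o Q).
  by apply: continuous_compact_integrable => //; exact: segment_compact.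
pose Phi t := \int[mu]_(s in `[a, t]) Q s.
have cPhi : {within `[a, b], continuous Phi}.
  by apply: parameterized_integral_continuous => //; exact: ltW.
have Phi' t : t \in `]a, b[ -> is_derive t 1 Phi (q t).
  rewrite -[_ \in _]/(t \in `]a, b[)%R => tab; have := tab.
  rewrite in_itv /= => /andP[at_ tb].
  have /continuous_within_itvP := cQ => /(_ ab) [/(_ t tab) cQt _ _].
  have [dPhi Phi'E] := continuous_FTC1_closed tb iQ at_ cQt.
  by apply: DeriveDef => //; rewrite -derive1E Phi'E QE.
have Phia : Phi a = 0 by rewrite /Phi set_itv1 Rintegral_set1.
exists Q, (Phi b / 2); split => //; first by rewrite mulrC divfK.
pose C t := cos (Phi t / 2); pose S t := sin (Phi t / 2).
have cH : {within `[a, b], continuous (fun t => Phi t / 2)}.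
  by move=> t; apply: cvgM; [exact: cPhi | exact: cvg_cst].
have cC : {within `[a, b], continuous C}.
  by move=> t; apply: (continuous_comp (cH t)); exact: continuous_cos.
have cS : {within `[a, b], continuous S}.
  by move=> t; apply: (continuous_comp (cH t)); exact: continuous_sin.
have CS t : C t ^+ 2 + S t ^+ 2 = 1 by exact: cos2Dsin2.
have cos2 t : cos (Phi t) = C t ^+ 2 - S t ^+ 2.
  by have := cosD (Phi t / 2) (Phi t / 2); rewrite -splitr !expr2.
have sin2 t : sin (Phi t) = 2 * (S t * C t).
  have := sinD (Phi t / 2) (Phi t / 2); rewrite -splitr => ->.
  by rewrite -/(S t) -/(C t); ring.
(* u = w exp(-i Phi / 2): its square is constant, hence so is u. *)
pose u1 t := x t * C t + y t * S t; pose u2 t := y t * C t - x t * S t.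
have cu1 : {within `[a, b], continuous u1}.
  by move=> t; apply: cvgD; apply: cvgM;
    (exact: cx || exact: cy || exact: cC || exact: cS).
have cu2 : {within `[a, b], continuous u2}.
  by move=> t; apply: cvgB; apply: cvgM;
    (exact: cx || exact: cy || exact: cC || exact: cS).
(* [U] is Re (u^2) = Re (z exp(-i Phi)). The real part suffices: with |u| = 1 it determines
   [u1 ^+ 2] and [u2 ^+ 2], and each component is then constant by the intermediate value
   argument. *)
pose U t := u1 t * u1 t - u2 t * u2 t.
have cU : {within `[a, b], continuous U}.
  move=> t; exact: (cvgB (cvgM (cu1 t) (cu1 t)) (cvgM (cu2 t) (cu2 t))).
have UE t : U t = p t * cos (Phi t) + r t * sin (Phi t).
  by rewrite cos2 sin2 /U /u1 /u2 /p /r; ring.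
have dU t : t \in `]a, b[ -> is_derive t 1 U 0.
  move=> tab; have [dp dr] := pr_is_derive tab; have dPhi := Phi' t tab.
  have -> : U = p * (cos \o Phi) + r * (sin \o Phi) by apply/funext => s; rewrite UE.
  apply: is_derive_eq.
  have := pr_orthogonal tab; have := pr_unit (itv_oo_cc_mem tab).
  rewrite /= /q /GRing.scale /=; set P' := 'D_1 p t; set R' := 'D_1 r t => E1 E2.
  set c := cos _; set s := sin _.
  (* [K1] and [K2] are the real and imaginary parts of z' = i q z, which follows from |z| = 1 and
     the orthogonality of z and z'. *)
  have K1 : P' + (R' * p t - P' * r t) * r t = 0.
    transitivity (P' * (1 - (p t ^+ 2 + r t ^+ 2)) + p t * (p t * P' + r t * R')).
      by ring.
    by rewrite E1 E2 subrr !mulr0 addr0.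
  have K2 : R' - (R' * p t - P' * r t) * p t = 0.
    transitivity (R' * (1 - (p t ^+ 2 + r t ^+ 2)) + r t * (p t * P' + r t * R')).
      by ring.
    by rewrite E1 E2 subrr !mulr0 addr0.
  transitivity ((P' + (R' * p t - P' * r t) * r t) * c
    + (R' - (R' * p t - P' * r t) * p t) * s); last by rewrite K1 K2 !mul0r addr0.
  ring.
have Ucst := derive0_cst (ltW ab) cU dU.
have uu t : t \in `[a, b] -> u1 t ^+ 2 + u2 t ^+ 2 = 1.
  move=> /xy1 E; transitivity ((x t ^+ 2 + y t ^+ 2) * (C t ^+ 2 + S t ^+ 2)).
    by rewrite /u1 /u2; ring.
  by rewrite E CS mulr1.
have aab : a \in `[a, b] by rewrite in_itv /= lexx ltW.
have u1b : u1 b = u1 a.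
  apply: within_continuous_sqr_cst => //; first exact: ltW.
  move=> t tab; have := uu t tab; have := uu a aab; have := Ucst t tab.
  by rewrite /U; lra.
have u2b : u2 b = u2 a.
  apply: within_continuous_sqr_cst => //; first exact: ltW.
  move=> t tab; have := uu t tab; have := uu a aab; have := Ucst t tab.
  by rewrite /U; lra.
have u1a : u1 a = x a by rewrite /u1 /C /S Phia mul0r cos0 sin0 mulr1 mulr0 addr0.
have u2a : u2 a = y a by rewrite /u2 /C /S Phia mul0r cos0 sin0 mulr1 mulr0 subr0.
rewrite -u1a -u2a -u1b -u2b /u1 /u2 -/(C b) -/(S b).
split.
  transitivity (x b * (C b ^+ 2 + S b ^+ 2)); first by rewrite CS mulr1.
  by ring.
transitivity (y b * (C b ^+ 2 + S b ^+ 2)); first by rewrite CS mulr1.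
by ring.
Qed.

Variable z : R -> R[i].
Hypothesis zE : forall t, t \in `[a, b] -> z t = (x t +i* y t) ^+ 2.

Let F t := cderive z t / (2 * pi%:C * 'i%C * z t).

Lemma sqr_coordE t : t \in `[a, b] -> z t = p t +i* r t.
Proof.
move=> /zE ->; rewrite expr2; simpc; rewrite /p /r !expr2; congr (_ +i* _); ring.
Qed.

(** Since z' = i q z, the logarithmic derivative z' / z is i q, and the factor i cancels: the
    integrand is real. *)
Lemma winding_integrand t : t \in `]a, b[ -> F t = (q t / (2 * pi))%:C.
Proof.
move=> tab; have zt := sqr_coordE (itv_oo_cc_mem tab).
have znear : \forall s \near t, z s = p s +i* r s.
  by apply: filterS (near_in_itvoo tab) => s /itv_oo_cc_mem/sqr_coordE.
have dz : cderive z t = 'D_1 p t +i* 'D_1 r t.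
  rewrite /cderive !derive1E; congr (_ +i* _); apply: near_eq_derive.
    by apply: filterS znear => s ->.
  by apply: filterS znear => s ->.
have dzE : cderive z t = 'i%C * (q t)%:C * z t.
  have := pr_orthogonal tab; have := pr_unit (itv_oo_cc_mem tab).
  rewrite dz zt /q; set P := p t; set Q := r t; set P' := 'D_1 p t; set Q' := 'D_1 r t.
  move=> E1 E2; simpc; apply/eqP; rewrite eq_complex /=; apply/andP; split; apply/eqP.
    transitivity (P' * (P ^+ 2 + Q ^+ 2) - P * (P * P' + Q * Q')); last by ring.
    by rewrite E1 E2 mulr1 mulr0 subr0.
  transitivity (Q' * (P ^+ 2 + Q ^+ 2) - Q * (P * P' + Q * Q')); last by ring.
  by rewrite E1 E2 mulr1 mulr0 subr0.
have z0 : z t != 0.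
  apply/eqP => z0; have := pr_unit (itv_oo_cc_mem tab).
  move: zt; rewrite z0 => -[<- <-] /eqP.
  by rewrite expr0n addr0 eq_sym oner_eq0.
have i0 : 'i%C != 0 :> R[i] by rewrite eq_complex /= oner_eq0 andbF.
have pi0 : pi%:C != 0 :> R[i] by rewrite eq_complex /= eqxx andbT gt_eqF// pi_gt0.
have cancel (k v u c : R[i]) : k != 0 -> u != 0 -> c != 0 ->
    k * v * u / (2 * c * k * u) = v / (2 * c).
  by move=> k0 u0 c0; field; rewrite c0 u0 k0.
rewrite /F dzE rmorphM /= fmorphV rmorphM /= rmorph_nat.
exact: cancel.
Qed.

(** The value is [th / pi] and not [th / (2 * pi)], because [th] is the angle of w while the
    integral measures the angle 2 th of z. *)
Lemma lift_winding : exists th,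
  [/\ mu.-integrable `[a, b] (EFin \o (fun t => complex.Re (F t))),
      mu.-integrable `[a, b] (EFin \o (fun t => complex.Im (F t))),
      \int[mu]_(t in `[a, b]) complex.Re (F t) = th / pi,
      \int[mu]_(t in `[a, b]) complex.Im (F t) = 0
    & x b = x a * cos th - y a * sin th /\ y b = x a * sin th + y a * cos th].
Proof.
have [Q [th [cQ QE intQ rot]]] := lift_rotation.
have iQ : mu.-integrable `[a, b] (EFin \o Q).
  by apply: continuous_compact_integrable => //; exact: segment_compact.
have iQ2 : mu.-integrable `[a, b] (EFin \o (fun t => Q t / (2 * pi))).
  apply: continuous_compact_integrable; first exact: segment_compact.
  by move=> t; apply: cvgM; [exact: cQ | exact: cvg_cst].
have i0 : mu.-integrable `[a, b] (EFin \o (fun=> 0 : R)).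
  apply: continuous_compact_integrable; first exact: segment_compact.
  by move=> t; exact: cvg_cst.
have [|iR intR] := @Rintegral_eq_oo _ (fun t => complex.Re (F t)) _ a b iQ2.
  by move=> t tab; rewrite winding_integrand//= QE.
have [|iI intI] := @Rintegral_eq_oo _ (fun t => complex.Im (F t)) _ a b i0.
  by move=> t tab; rewrite winding_integrand.
exists th; split => //.
  rewrite intR RintegralZr// intQ.
  by rewrite invfM mulrACA divff ?pnatr_eq0// mul1r.
by rewrite intI Rintegral_cst// mul0r.
Qed.

End Lifting.

(** * The determinant along a curve of tangent planes *)

Section LocalFrame.
Context {R : realType} {V : normedVectType R}.

Lemma linear_Ck1 (W : normedModType R) (l : {linear V -> W}) : Ck_on 1 [set: V] l.
Proof.
have cl : continuous l by exact: findim_linear_continuous.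
split=> [x _|v x _]; first exact: linear_differentiable.
rewrite (_ : (fun x => 'D_v l x) = cst (l v)); first exact: cst_continuous.
by apply/funext => y; rewrite deriveE ?diff_lin//; exact: linear_differentiable.
Qed.

Lemma C1_near_linear (W : normedModType R) (l : {linear V -> W}) (c : R -> V) (t0 : R) :
  C1_near t0 c -> C1_near t0 (l \o c).
Proof. exact: (C1_near_comp openT (linear_Ck1 l)). Qed.

Lemma div_conjc (a b : R) :
  (a +i* b) / conjc (a +i* b) =
  ((a ^+ 2 - b ^+ 2) / (a ^+ 2 + b ^+ 2)) +i* ((2 * (a * b)) / (a ^+ 2 + b ^+ 2)).
Proof.
rewrite -[_^-1]/((a / (a ^+ 2 + (- b) ^+ 2)) -i* (- b / (a ^+ 2 + (- b) ^+ 2))) sqrrN.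
set m := (_ + _)^-1.
by apply/eqP; rewrite eq_complex /=; apply/andP; split; apply/eqP; rewrite -/m; ring.
Qed.

Variables (omega : {skew_symmetric V}) (J : 'End(V)).
Hypothesis JJ : forall v, J (J v) = - v.
Hypothesis omegaJ : forall u v, omega (J u) (J v) = omega u v.
Variables (n : nat) (X : {vspace V}) (e : n.-tuple V).
Hypothesis eX : orthonormal_basis omega J X e.

Lemma C1_near_omega (c : R -> V) (y : V) (t0 : R) :
  C1_near t0 c -> C1_near t0 (fun t => omega (c t) y).
Proof.
have lin : linear (fun v => omega v y) by move=> a u v; rewrite linearPl.
pose lM := GRing.isLinear.Build _ _ _ _ _ lin.
pose l : {linear V -> R} := HB.pack (fun v => omega v y) lM.
exact: (@C1_near_linear _ l).
Qed.

Local Notation planeU U := (lagr_proj omega J X e U).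

Lemma unitary_act_basis_mem U j :
  unitary_act omega J e U (tnth e j) \in planeU U.
Proof.
apply: lagr_proj_mem => //; case: eX => eB _.
by rewrite (basis_mem eB)// mem_tnth.
Qed.

(** The images under [U] of the vectors of [e] form a frame of the plane with matrix exactly [U], to
    which [det2_frame] applies. *)
Lemma det2_lagr_proj U : U \is unitarymx -> det2 omega J X e (planeU U) = (\det U) ^+ 2.
Proof.
move=> Uu; have uu := det_unitary Uu.
have u0 : \det U != 0.
  by apply: contra_eq_neq uu => ->; rewrite mul0r eq_sym oner_eq0.
have FE := det_frame_basis JJ omegaJ eX U.
rewrite (@det2_frame _ _ _ _ JJ omegaJ _ _ _ eX U
  (fun j => unitary_act omega J e U (tnth e j)))// ?FE//.
  have c0 : conjc (\det U) != 0 by rewrite conjc_eq0.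
  by apply: (mulIf c0); rewrite divfK// expr2 -mulrA uu mulr1.
by move=> j; exact: unitary_act_basis_mem.
Qed.

(* The local frame is the image by the differentials of g along the curve of
   vectors u_j of E, chosen so that at t0 its matrix is the unitary matrix U0. *)
Lemma det2_tangent_plane_C1 (N : set V) (d : nat) (c : R -> V) (t0 : R) U0 :
  submanifold d N -> C1_near t0 c -> N (c t0) ->
  U0 \is unitarymx -> planeU U0 = tangent_plane N (c t0) ->
  exists p r : R -> R, [/\ C1_near t0 p, C1_near t0 r &
    \forall t \near t0, N (c t) ->
      (exists2 U, U \is unitarymx & planeU U = tangent_plane N (c t)) ->
      det2 omega J X e (tangent_plane N (c t)) = p t +i* r t].
Proof.
move=> subN c1 Nc0 U0u U0T.
have [A [B [f [g [E [[oA Ac0] oB fg _ chart]]]]]] := subN _ Nc0.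
case: (fg) => sf sg fK gK.
have tgtP := mem_tangent_plane_chart oA oB fg chart.
have /choice[u uP] : forall j, exists u, u \in E /\
    unitary_act omega J e U0 (tnth e j) = 'D_u g (f (c t0)).
  move=> j; have /tgtP[//|//|u uE ->] :
    unitary_act omega J e U0 (tnth e j) \in tangent_plane N (c t0).
    by rewrite -U0T; exact: unitary_act_basis_mem.
  by exists u.
pose v j t : V := 'D_(u j) g (f (c t)).
(* The frame already contains one derivative of [g], so its C^1 regularity uses [g] at order 2. *)
have v1 j : C1_near t0 (v j).
  apply: (@C1_near_comp _ _ _ B ('D_(u j) g) (f \o c)) => //.
  - by apply: (sg 2%N).2.
  - exact: (fK _ Ac0).1.
  - by apply: (C1_near_comp oA) => //; exact: sf.
pose D t := \det (frame_mx omega J e (fun j => v j t)).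
have [a [b [a1 b1 DE]]] : exists a b : R -> R,
    [/\ C1_near t0 a, C1_near t0 b & forall t, D t = a t +i* b t].
  have [D1R D1I] : on_Re_Im (fun h : R -> R => C1_near t0 h) D.
    apply: on_Re_Im_det => [a|h1 h2|h1 h2|k j].
    - exact: C1_near_cst.
    - exact: C1_nearD.
    - exact: C1_nearM.
    split; under eq_fun do rewrite mxE /=; first exact: C1_near_omega.
    under eq_fun do rewrite -mulN1r.
    by apply: C1_nearM; [exact: C1_near_cst|exact: C1_near_omega].
  exists (fun t => complex.Re (D t)), (fun t => complex.Im (D t)).
  split; [exact: D1R|exact: D1I|move=> t].
  by case: (D t).
pose m t := a t * a t + b t * b t.
have m1 : C1_near t0 m by apply: C1_nearD; apply: C1_nearM.
have D0 : D t0 != 0.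
  rewrite /D (_ : frame_mx _ _ _ _ = U0).
    by have := unitarymx_unit U0u; rewrite unitmxE unitfE.
  rewrite -[RHS](det_frame_basis JJ omegaJ eX U0); congr frame_mx.
  by apply/funext => j; rewrite (uP j).2.
have m_eq0 t : (m t == 0) = (D t == 0).
  rewrite DE eq_complex /= /m -!expr2.
  by rewrite paddr_eq0 ?sqr_ge0// !sqrf_eq0.
have m0 : m t0 != 0 by rewrite m_eq0.
have mV := C1_nearV m0 m1.
exists (fun t => (a t * a t + (-1) * (b t * b t)) * (m t)^-1),
       (fun t => (2 * (a t * b t)) * (m t)^-1); split.
- apply: C1_nearM mV; apply: C1_nearD; first exact: C1_nearM.
  apply: C1_nearM; [exact: C1_near_cst|exact: C1_nearM].
- apply: C1_nearM mV; apply: C1_nearM; first exact: C1_near_cst.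
  exact: C1_nearM.
- have [_ _ mc] := nbhs_singleton (C1_near_derive m1).
  have [_ _ cc] := nbhs_singleton (C1_near_derive c1).
  (* [c] is meant to be a C^1 extension of a piece of the curve and may leave [N] beyond that piece,
     so membership in [N] and a unitary matrix over the plane are assumed at [t]. *)
  near=> t => Nt [U Uu UT].
  have mt0 : m t != 0.
    near: t; apply: (mc [set y | y != 0]).
    exact: (open_nbhs_nbhs (conj (@open_neq R 0) m0)).
  have At : A (c t) by near: t; apply: (cc A); exact: open_nbhs_nbhs.
  rewrite -UT (@det2_frame _ _ _ _ JJ omegaJ _ _ _ eX U (v^~ t))//; last first.
  + by rewrite -/(D t) -m_eq0.
  + by move=> j; rewrite UT; apply/(tgtP _ _ At Nt); exists (u j); [exact: (uP j).1|].
  rewrite -/(D t) DE div_conjc /m !expr2; congr (_ +i* _).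
  by rewrite mulN1r.
Unshelve. all: by end_near. Qed.

End LocalFrame.

Lemma Ck1_C1_near (R : realType) (W : normedModType R) (g : R -> W) (t0 : R) :
  Ck_on 1 [set: R] g -> C1_near t0 g.
Proof.
move=> [dg cg]; near=> t; split.
  by apply/derivable1_diffP; exact: dg.
exact: cg.
Unshelve. all: by end_near. Qed.

Theorem theorem1p3 (R : realType) (n : nat) (V : normedVectType R)
    (omega : {skew_symmetric V}) (J : 'End(V)) (X : {vspace V})
    (e : n.-tuple V) (N : set V) (gamma : R -> V) (Gt : R -> 'M[R[i]^o]_n) :
  \dim {:V} = (2 * n)%N ->
  is_psymplectic omega ->
  compatible_complex_structure omega J ->
  lagrangian_plane omega n X ->
  orthonormal_basis omega J X e ->
  lagrangian_submanifold omega N ->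
  piecewise_C1_closed_curve gamma ->
  (forall t : R, t \in `[0, 1] -> N (gamma t)) ->
  {within `[0, 1], continuous Gt} ->
  Gt 0 = Gt 1 ->
  (forall t : R, t \in `[0, 1] ->
     (Gt t : 'M[R[i]]_n) \is unitarymx /\
     lagr_proj omega J X e (Gt t) = tangent_plane N (gamma t)) ->
  exists k : int, maslov_index omega J X e N gamma = (2 * k)%:~R.
Proof.
move=> _ _ [JJ omegaJ _] _ eX [[d subN] _] [_ [m [s [s0 s1 sP]]]] Ngamma cG G01 GP.
pose z t := det2 omega J X e (tangent_plane N (gamma t)).
pose w t := \det (Gt t : 'M[R[i]]_n).
have [cx cy] := within_continuous_det cG.
pose x t := complex.Re (w t); pose y t := complex.Im (w t).
have wE t : w t = x t +i* y t by rewrite /x /y; case: (w t).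
have xy1 t : t \in `[0, 1] -> x t ^+ 2 + y t ^+ 2 = 1.
  move=> /GP[/det_unitary]; rewrite -/(w t) wE; simpc => -[E _] _.
  by rewrite -E !expr2.
have zE t : t \in `[0, 1] -> z t = (x t +i* y t) ^+ 2.
  by move=> /GP[Gu GT]; rewrite /z -GT (det2_lagr_proj JJ omegaJ eX Gu) -wE.
have s_ge0 i : (i <= m)%N -> 0 <= s i.
  elim: i => [_|i IH im]; first by rewrite s0.
  by rewrite (le_trans (IH (ltnW im)))// ltW//; exact: (sP _ im).1.
(* The upper bound is known at index [m], so the induction runs downwards. *)
have s_le1 i : (i <= m)%N -> s i <= 1.
  have H k : (k <= m)%N -> s (m - k)%N <= 1.
    elim: k => [_|k IH km]; first by rewrite subn0 s1.
    apply: le_trans (IH (ltnW km)); rewrite -(subnSK km) ltW//.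
    by apply: (sP _ _).1; rewrite -subn_gt0 subKn.
  by move=> im; rewrite -(subKn im); apply: H; exact: leq_subr.
pose F t := cderive z t / (2 * pi%:C * 'i%C * z t).
pose mu := @lebesgue_measure R.
have piece i : (i < m)%N -> exists th,
  [/\ mu.-integrable `[s i, s i.+1] (EFin \o (fun t => complex.Re (F t))),
      mu.-integrable `[s i, s i.+1] (EFin \o (fun t => complex.Im (F t))),
      \int[mu]_(t in `[s i, s i.+1]) complex.Re (F t) = th / pi,
      \int[mu]_(t in `[s i, s i.+1]) complex.Im (F t) = 0
    & x (s i.+1) = x (s i) * cos th - y (s i) * sin th /\
      y (s i.+1) = x (s i) * sin th + y (s i) * cos th].
  move=> im; have [sii [g g1 gE]] := sP _ im.
  have sub t : t \in `[s i, s i.+1] -> t \in `[0, 1].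
    rewrite !in_itv /= => /andP[a b].
    by rewrite (le_trans (s_ge0 _ (ltnW im)) a) (le_trans b (s_le1 _ im)).
  have subs : `[s i, s i.+1] `<=` `[0, 1] by move=> t; exact: sub.
  apply: lift_winding => //.
  - exact: continuous_subspaceW subs cx.
  - exact: continuous_subspaceW subs cy.
  - by move=> t /sub; exact: xy1.
  (* The local C^1 functions are built along the extension [g], defined on both sides of [t0]; they
     are compared with z only inside the piece, where [g] equals [gamma]. *)
  - move=> t0 t0i; have [G0u G0T] := GP _ (sub _ t0i).
    have [|||p [r [p1 r1 E]]] := @det2_tangent_plane_C1 _ _ _ _ JJ omegaJ _ _ _ eX
      N d g t0 (Gt t0) subN (Ck1_C1_near t0 g1).
    + by rewrite -gE//; exact/Ngamma/sub.
    + exact: G0u.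
    + by rewrite -gE.
    exists p, r; split => //; apply: filterS E => t E ti.
    have tI := sub _ ti; have [Gu GT] := GP _ tI.
    have : z t = p t +i* r t.
      rewrite /z gE//; apply: E; first by rewrite -gE//; exact: Ngamma.
      by exists (Gt t) => //; rewrite -gE.
    rewrite zE// expr2; simpc => -[<- <-]; split; first by rewrite !expr2.
    by rewrite mulr_natl mulr2n [y t * x t]mulrC.
  - by move=> t /sub; exact: zE.
have total i : (i <= m)%N -> exists th,
  [/\ mu.-integrable `[0, s i] (EFin \o (fun t => complex.Re (F t))),
      mu.-integrable `[0, s i] (EFin \o (fun t => complex.Im (F t))),
      \int[mu]_(t in `[0, s i]) complex.Re (F t) = th / pi,
      \int[mu]_(t in `[0, s i]) complex.Im (F t) = 0
    & x (s i) = x 0 * cos th - y 0 * sin th /\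
      y (s i) = x 0 * sin th + y 0 * cos th].
  elim: i => [_|i IH im].
    exists 0; rewrite s0 set_itv1 !Rintegral_set1 cos0 sin0.
    rewrite !mulr0 !mulr1 mul0r subr0 add0r.
    have m1 (f : R -> \bar R) : mu.-integrable [set 0] f.
      apply: null_set_integrable => //; first exact: measurable_fun_set1.
      exact: lebesgue_measure_set1.
    by split.
  have [th [iR iI intR intI [xi yi]]] := IH (ltnW im).
  have [th' [iR' iI' intR' intI' [xi' yi']]] := piece _ im.
  have si := ltW (sP _ im).1; have si0 := s_ge0 _ (ltnW im).
  have [jR jntR] := Rintegral_cat si0 si iR iR'.
  have [jI jntI] := Rintegral_cat si0 si iI iI'.
  exists (th + th'); split => //.
  - by rewrite jntR intR intR' mulrDl.
  - by rewrite jntI intI intI' addr0.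
  - by rewrite xi' yi' xi yi cosD sinD; split; ring.
have [th [_ _ intR intI []]] := total _ (leqnn m).
rewrite s1 in intR intI *.
have -> : x 1 = x 0 by rewrite /x /w G01.
have -> : y 1 = y 0 by rewrite /y /w G01.
move=> x0E y0E.
(* The rotation by [th] fixes the unit vector [(x 0, y 0)]; taking the inner product with that
   vector gives cos th. *)
have c1 : cos th = 1.
  have E : x 0 ^+ 2 + y 0 ^+ 2 = 1 by apply: xy1; rewrite in_itv /= lexx ler01.
  transitivity (x 0 * (x 0 * cos th - y 0 * sin th)
      + y 0 * (x 0 * sin th + y 0 * cos th)).
    transitivity ((x 0 ^+ 2 + y 0 ^+ 2) * cos th); first by rewrite E mul1r.
    by ring.
  by rewrite -x0E -y0E -!expr2.
(* The integral is [th / pi] with th = 2 pi k, hence 2 k. *)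
have [k thE] := cos_eq1 c1.
exists k; rewrite /maslov_index /winding_integral /cintegral.
rewrite [X in X +i* _]intR [X in _ +i* X]intI thE.
have -> : (2 * k)%:~R = ((2 * k)%:~R : R)%:C :> R[i] by rewrite rmorph_int.
by rewrite intrM mulrAC mulfK// gt_eqF// pi_gt0.
Qed.
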